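(* Let $\mathcal{D}=(S,\mathbf{P},s_I)$ be a finite Markov chain, let $G\subseteq S$ be a set of absorbing states, let $S_0=\{s\in S\mid \Pr_s(\lozenge G)=0\}$ and $S_?=S\setminus(G\cup S_0)$, and assume $S_?\neq\emptyset$. Let $k\ge 0$ be such that $\Pr_s(\square^{\le k}S_?)<1$ for all $s\in S_?$. Then \[ \Pr(\lozenge^{\le k}G)+\Pr(\square^{\le k}S_?)\cdot\min_{s\in S_?}\frac{\Pr_s(\lozenge^{\le k}G)}{1-\Pr_s(\square^{\le k}S_?)} \;\le\;\Pr(\lozenge G)\;\le\; \Pr(\lozenge^{\le k}G)+\Pr(\square^{\le k}S_?)\cdot\max_{s\in S_?}\frac{\Pr_s(\lozenge^{\le k}G)}{1-\Pr_s(\square^{\le k}S_?)}. \]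
   Context: A finite Markov chain $\mathcal{D}=(S,\mathbf{P},s_I)$ has a finite state set $S$, transition probabilities $\mathbf{P}\colon S\times S\to[0,1]$ with $\sum_{s'}\mathbf{P}(s,s')=1$ for all $s$, and an initial state $s_I$. A state $s$ is absorbing if $\mathbf{P}(s,s)=1$. A path is an infinite sequence $s_0s_1s_2\dots$ of states with $\mathbf{P}(s_i,s_{i+1})>0$ for all $i$. $\Pr_s$ denotes the standard probability measure on paths starting in $s$, and $\Pr=\Pr_{s_I}$. For $H\subseteq S$ and $k\in\mathbb{N}$: $\lozenge^{\le k}G$ is the set of paths with $s_j\in G$ for some $j\le k$; $\lozenge G$ is the set of paths with $s_j\in G$ for some $j\ge0$; $\square^{\le k}H$ is the set of paths with $s_0,\dots,s_k\in H$. *)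

(* Defs.v *)
From HB Require Import structures.
From mathcomp Require Import all_boot all_order all_algebra.
From mathcomp Require Import ring lra.
From mathcomp Require Import all_classical all_reals all_analysis.

Set Implicit Arguments.
Unset Strict Implicit.
Unset Printing Implicit Defensive.

Import Order.TTheory GRing.Theory Num.Theory.
Import numFieldNormedType.Exports.

Local Open Scope classical_set_scope.
Local Open Scope ring_scope.

Record markov_chain (R : realType) := MarkovChain {
  mc_state :> finType;
  mc_trans : mc_state -> mc_state -> R;
  mc_init : mc_state;
  mc_trans01 : forall s t, 0 <= mc_trans s t <= 1;
  mc_trans_sum : forall s, \sum_t mc_trans s t = 1 }.

Definition absorbing (R : realType) (D : markov_chain R) (s : D) : Prop :=
  mc_trans s s = 1.

Record infpath (R : realType) (D : markov_chain R) := InfPath {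
  infpath_state :> nat -> D;
  infpath_step : forall i,
    0 < mc_trans (infpath_state i) (infpath_state i.+1) }.

Lemma mc_succ (R : realType) (D : markov_chain R) (s : D) :
  exists t, 0 < mc_trans s t.
Proof.
apply: contrapT => /forallNP no.
have := mc_trans_sum s; rewrite big1; first by move/esym/eqP; rewrite oner_eq0.
move=> t _; apply/eqP; have /andP[h _] := mc_trans01 s t.
by rewrite eq_le h andbT leNgt; apply/negP/no.
Qed.

Lemma infpath_inhabited (R : realType) (D : markov_chain R) :
  exists p : infpath D, p 0%N = mc_init D.
Proof.
pose nx (s : D) := projT1 (cid (mc_succ s)).
have nxP s : 0 < mc_trans s (nx s) by rewrite /nx; case: cid.
by exists (@InfPath _ _ (fun n => iter n nx (mc_init D)) (fun i => nxP _)).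
Qed.

HB.instance Definition _ (R : realType) (D : markov_chain R) :=
  gen_eqMixin (infpath D).
HB.instance Definition _ (R : realType) (D : markov_chain R) :=
  gen_choiceMixin (infpath D).
HB.instance Definition _ (R : realType) (D : markov_chain R) :=
  isPointed.Build (infpath D) (projT1 (cid (infpath_inhabited D))).

Definition cylinder (R : realType) (D : markov_chain R) (w : seq D)
    : set (infpath D) :=
  [set p | mkseq p (size w) = w].

Notation paths D := (g_sigma_algebraType (range (@cylinder _ D))).

(* Product of the transition probabilities along the word [s :: w]. *)
Fixpoint word_prob (R : realType) (D : markov_chain R) (s : D) (w : seq D) : R :=
  if w is t :: w' then mc_trans s t * word_prob t w' else 1.

(* Paths starting elsewhere get mass 0, since [cylinder [:: s]] has mass 1. *)
Definition is_path_measure (R : realType) (D : markov_chain R) (s : D)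
    (mu : probability (paths D) R) : Prop :=
  forall w : seq D, mu (cylinder (s :: w)) = (word_prob s w)%:E.

(* Existence by inverse-transform sampling: [v] uniform in [0, 1[ selects the
   successor [t] of [s] with [cum s t <= v < cum s t + mc_trans s t], and [v]
   is then rescaled to [0, 1[ for the next step.  The preimage of a cylinder is
   a half-open interval whose length is the probability of the word. *)
Section path_measure_construction.
Context (R : realType) (D : markov_chain R).
Implicit Types (s t : D) (v : R) (w : seq D).

Let cums s n : R := \sum_(t : D | (enum_rank t < n)%N) mc_trans s t.
Let cum s t : R := cums s (enum_rank t).

Let trans_ge0 s t : 0 <= mc_trans s t.
Proof. by have /andP[] := mc_trans01 s t. Qed.

Let cums0 s : cums s 0 = 0.
Proof. by rewrite /cums big_pred0. Qed.

Let cumsT s : cums s #|D| = 1.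
Proof.
by rewrite /cums -(mc_trans_sum s); apply: eq_bigl => t; rewrite ltn_ord.
Qed.

Let cums_le s m n : (m <= n)%N -> cums s m <= cums s n.
Proof.
move=> mn; rewrite /cums [leRHS](bigID (fun t => (enum_rank t < m)%N)) /=.
have -> : \sum_(t : D | (enum_rank t < m)%N) mc_trans s t =
    \sum_(t : D | (enum_rank t < n)%N && (enum_rank t < m)%N) mc_trans s t.
  apply: eq_bigl => t; case: (ltnP (enum_rank t) m) => h; rewrite ?andbF ?andbT//.
  by rewrite (leq_trans h).
by rewrite lerDl; apply: sumr_ge0.
Qed.

Let cumsS s t : cums s (enum_rank t).+1 = cum s t + mc_trans s t.
Proof.
rewrite /cum /cums (bigD1 t)//= addrC; congr (_ + _); apply: eq_bigl => u.
rewrite ltnS leq_eqVlt; have [->|ut] := eqVneq u t.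
  by rewrite andbF ltnn.
by rewrite andbT (_ : (_ == _ :> nat) = false)//; apply/negbTE; rewrite (inj_eq val_inj) (inj_eq enum_rank_inj).
Qed.

Let cum_ge0 s t : 0 <= cum s t.
Proof. by apply: sumr_ge0. Qed.

Let cumS_le1 s t : cum s t + mc_trans s t <= 1.
Proof. by rewrite -cumsS -(cumsT s); apply: cums_le; rewrite ltn_ord. Qed.

Let hit s v t := (cum s t <= v) && (v < cum s t + mc_trans s t).
Let next s v : D := odflt s [pick t | hit s v t].

Let hit_uniq s v t u : hit s v t -> hit s v u -> t = u.
Proof.
have lt_abs t' u' : hit s v t' -> hit s v u' -> ~ (enum_rank t' < enum_rank u')%N.
  move=> /andP[_ a] /andP[b _] h; have := cums_le s h; rewrite cumsS => c.
  by have := lt_le_trans a (le_trans c b); rewrite ltxx.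
move=> ht hu; apply: enum_rank_inj; apply: val_inj => /=.
by have [h|h|//] := ltngtP (enum_rank t) (enum_rank u); case: (lt_abs _ _ _ _ h).
Qed.

Let hit_ex s v : 0 <= v < 1 -> exists t, hit s v t.
Proof.
move=> /andP[v0 v1]; apply: contrapT => /forallNP no.
have h n : (n <= #|D|)%N -> cums s n <= v.
  elim: n => [|n IHn] nD; first by rewrite cums0.
  have := no (enum_val (Ordinal nD)); rewrite /hit -cumsS /cum enum_valK /=.
  by rewrite IHn 1?ltnW//= => /negP; rewrite -leNgt.
by have := le_lt_trans (h _ (leqnn _)) v1; rewrite cumsT ltxx.
Qed.

Let nextP s v t : 0 <= v < 1 -> (next s v == t) = hit s v t.
Proof.
move=> v01; rewrite /next; case: pickP => [u hu|no] /=; last first.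
  by have [u] := hit_ex s v01; rewrite no.
apply/eqP/idP => [<-//|]; exact: hit_uniq.
Qed.

Let resc s v : R := (v - cum s (next s v)) / mc_trans s (next s v).

Let hit_next s v : 0 <= v < 1 -> hit s v (next s v).
Proof. by move=> v01; rewrite -nextP. Qed.

Let next_gt0 s v : 0 <= v < 1 -> 0 < mc_trans s (next s v).
Proof.
move=> /(hit_next s)/andP[a b].
by have := le_lt_trans a b; rewrite ltrDl.
Qed.

Let resc01 s v : 0 <= v < 1 -> 0 <= resc s v < 1.
Proof.
move=> v01; have p0 := next_gt0 s v01; have /andP[a b] := hit_next s v01.
by rewrite /resc divr_ge0 ?subr_ge0//= ltr_pdivrMr// mul1r ltrBlDl.
Qed.

Fixpoint sample s v n : D :=
  if n is n'.+1 then sample (next s v) (resc s v) n' else s.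

Let sample_step s v n : 0 <= v < 1 ->
  0 < mc_trans (sample s v n) (sample s v n.+1).
Proof.
elim: n s v => [|n IHn] s v v01; first exact: next_gt0.
exact: (IHn (next s v) (resc s v) (resc01 s v01)).
Qed.

Let mkseqS (T : Type) (f : nat -> T) n :
  mkseq f n.+1 = f 0%N :: mkseq (fun i => f i.+1) n.
Proof. by rewrite /mkseq /= (iotaDl 1 0) -map_comp. Qed.

Let sample_itv s w : exists a b : R, [/\ 0 <= a, a <= b, b <= 1,
  b - a = word_prob s w & forall v, 0 <= v < 1 ->
  (mkseq (sample s v) (size w).+1 == s :: w) = (a <= v < b)].
Proof.
elim: w s => [|t w IHw] s /=.
  exists 0, 1; split; rewrite ?ler01 ?subr0// => v ->.
  by rewrite /mkseq/= eqxx.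
have [a [b [a0 ab b1 abE H]]] := IHw t.
have [p0|p0] := eqVneq (mc_trans s t) 0.
  exists 0, 0; split; rewrite ?ler01 ?subr0 ?p0 ?mul0r// => v v01.
  rewrite mkseqS eqseq_cons eqxx/= mkseqS eqseq_cons/= nextP// /hit p0 addr0.
  by case: (leP 0 v); case: (leP (cum s t) v); rewrite //= ?ltNge => h1 h2; rewrite ?h1 ?h2.
have {}p0 : 0 < mc_trans s t by rewrite lt_def p0 trans_ge0.
have c0 := cum_ge0 s t; have c1 := cumS_le1 s t.
exists (cum s t + mc_trans s t * a), (cum s t + mc_trans s t * b); split.
- by rewrite addr_ge0// mulr_ge0// ltW.
- by rewrite lerD2l ler_pM2l.
- by apply: le_trans c1; rewrite lerD2l ler_piMr// ltW.
- by rewrite -abE; ring.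
move=> v v01; rewrite mkseqS eqseq_cons eqxx/=.
have -> : (cum s t + mc_trans s t * a <= v < cum s t + mc_trans s t * b) =
    (a <= (v - cum s t) / mc_trans s t < b).
  by rewrite ler_pdivlMr// ltr_pdivrMr// lerBrDl ltrBlDl ![mc_trans s t * _]mulrC.
have [nt|nt] := eqVneq (next s v) t.
  have r01 := resc01 s v01.
  by rewrite -[mkseq _ _]/(mkseq (sample (next s v) (resc s v)) (size w).+1) /resc nt H// -nt.
rewrite mkseqS eqseq_cons /= (negbTE nt)/=; apply/esym/negbTE/negP => /andP[h1 h2].
move: nt; rewrite nextP// /hit => /negP; apply; apply/andP; split.
  by have := le_trans a0 h1; rewrite pmulr_lge0 ?invr_gt0// subr_ge0.
by have := lt_le_trans h2 b1; rewrite ltr_pdivrMr// mul1r ltrBlDl.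
Qed.

Let in01 : 0 <= (0 : R) < 1. Proof. by rewrite lexx ltr01. Qed.

Let trunc01 v : R := if 0 <= v < 1 then v else 0.

Let trunc01P v : 0 <= trunc01 v < 1.
Proof. by rewrite /trunc01; case: ifP. Qed.

Definition sample_path s (v : measurableTypeR R) : paths D :=
  @InfPath _ _ (sample s (trunc01 v)) (fun n => sample_step s n (trunc01P v)).

Let I01 : set R := `[0, 1[%classic.

Let mI01 : measurable (I01 : set (measurableTypeR R)).
Proof. exact: measurable_itv. Qed.

Let sample_cyl s w : exists a b : R, [/\ a <= b,
  b - a = word_prob s w &
  sample_path s @^-1` (cylinder (s :: w)) `&` I01 = `[a, b[%classic].
Proof.
have [a [b [a0 ab b1 abE H]]] := sample_itv s w.
exists a, b; split=> //; apply/seteqP; split=> v /=; rewrite /I01 /= !in_itv/=.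
  case=> /eqP + v01; rewrite /= /trunc01 v01.
  by rewrite -[X in mkseq _ X]/((size w).+1) H.
move=> vab; have /andP[v1 v2] := vab.
have v01 : 0 <= v < 1 by rewrite (le_trans a0 v1) (lt_le_trans v2 b1).
by split=> //; apply/eqP; rewrite /= /trunc01 v01 -[X in mkseq _ X]/((size w).+1) H.
Qed.

Let sample_path_measurable s :
  measurable_fun [set: measurableTypeR R] (sample_path s).
Proof.
apply: (@measurability _ _ (measurableTypeR R) (paths D) setT (sample_path s)
  (range (@cylinder _ D))) => //.
move=> _ [_ [w _ <-] <-]; rewrite setTI.
have -> : sample_path s @^-1` cylinder w =
   (sample_path s @^-1` cylinder w `&` I01) `|`
   (sample_path s @^-1` cylinder w `&` ~` I01).
  by rewrite -setIUr setUv setIT.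
apply: measurableU.
  case: w => [|t w].
    by rewrite (_ : _ @^-1` _ = setT) ?setTI//; apply/seteqP.
  have [->|ts] := eqVneq t s.
    by have [a [b [_ _ ->]]] := sample_cyl s w; exact: measurable_itv.
  rewrite (_ : _ @^-1` _ = set0) ?set0I; first exact: measurable0.
  by rewrite -subset0 => v /=; rewrite /cylinder/= mkseqS => -[/esym/eqP]; rewrite (negbTE ts).
have [h|h] := pselect (cylinder w (sample_path s 2)).
  rewrite (_ : _ `&` _ = ~` I01); first exact: measurableC.
  apply/seteqP; split=> [v []//|v vI]; split => //=.
  suff -> : sample_path s v = sample_path s 2 by [].
  rewrite /sample_path; move: (trunc01P v) (trunc01P 2).
  have -> : trunc01 v = 0.
    by rewrite /trunc01; case: ifPn => // v01; case: vI; rewrite /I01/= in_itv.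
  have -> : trunc01 2 = 0 by rewrite /trunc01; case: ifP => // /andP[_]; lra.
  by move=> p q; rewrite (bool_irrelevance p q).
rewrite (_ : _ `&` _ = set0); first exact: measurable0.
rewrite -subset0 => v [/= hv vI]; case: h.
suff -> : sample_path s 2 = sample_path s v by [].
rewrite /sample_path; move: (trunc01P v) (trunc01P 2).
have -> : trunc01 v = 0.
  by rewrite /trunc01; case: ifPn => // v01; case: vI; rewrite /I01/= in_itv.
have -> : trunc01 2 = 0 by rewrite /trunc01; case: ifP => // /andP[_]; lra.
by move=> p q; rewrite (bool_irrelevance p q).
Qed.

Definition lebesgue01 : set (measurableTypeR R) -> \bar R := mrestr (@lebesgue_measure R) mI01.
HB.instance Definition _ := Measure.on lebesgue01.

Let lebesgue01T : lebesgue01 setT = 1%E.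
Proof.
by rewrite /lebesgue01 /mrestr setTI lebesgue_measure_itv/= lte01 oppr0 adde0.
Qed.
HB.instance Definition _ := Measure_isProbability.Build _ _ _ lebesgue01 lebesgue01T.
HB.instance Definition _ s :=
  isMeasurableFun.Build _ _ _ _ (sample_path s) (sample_path_measurable s).

Lemma exists_path_measure s :
  exists mu : probability (paths D) R, is_path_measure s mu.
Proof.
exists (distribution lebesgue01 (sample_path s)) => w.
have [a [b [ab abE E]]] := sample_cyl s w.
transitivity (@lebesgue_measure R (sample_path s @^-1` cylinder (s :: w) `&` I01)).
  by [].
rewrite E lebesgue_measure_itv/= lte_fin.
rewrite -abE; case: ltP => [_|ba]; first by rewrite -EFinB.
by rewrite (_ : a = b) ?subrr//; apply/eqP; rewrite eq_le ab.
Qed.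

End path_measure_construction.

Lemma path_measure_unique (R : realType) (D : markov_chain R) (s : D)
    (mu nu : probability (paths D) R) :
  is_path_measure s mu -> is_path_measure s nu ->
  forall A : set (paths D), measurable A -> mu A = nu A.
Proof.
move=> hmu hnu.
have hd (m : probability (paths D) R) : is_path_measure s m ->
    forall t w, t != s -> m (cylinder (t :: w)) = 0%E.
  move=> hm t w ts.
  have mc v : measurable (cylinder v : set (paths D)).
    by apply: sub_sigma_algebra; exists v.
  have : m (~` cylinder [:: s]) = 0%E.
    by rewrite probability_setC// hm /= subee.
  apply: subset_measure0 => //; first exact: measurableC.
  move=> p; rewrite /cylinder/= /mkseq/= => -[pt _] [ps].
  by move: ts; rewrite -pt ps eqxx.
pose G : set (set (paths D)) := range (@cylinder _ D) `|` [set set0].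
apply: (measure_unique G (fun=> setT)).
- apply/seteqP; split.
    by apply: sub_smallest2r => // A hA; left.
  apply: smallest_sub; first exact: smallest_sigma_algebra.
  move=> A [hA|->]; first exact: sub_sigma_algebra.
  exact: sigma_algebra0.
- move=> A B [[v _ <-]|->]; last by rewrite set0I; right.
  move=> [[w _ <-]|->]; last by rewrite setI0; right.
  wlog vw : v w / (size v <= size w)%N.
    by move=> H; case: (leqP (size v) (size w)) => [|/ltnW]; [|rewrite setIC]; exact: H.
  have tk (p : paths D) : cylinder w p -> mkseq p (size v) = take (size v) w.
    move=> pw; rewrite -[in RHS]pw /mkseq -map_take take_iota.
    by rewrite (minn_idPl vw).
  have [e|ne] := eqVneq (take (size v) w) v.
    left; exists w => //; apply/seteqP; split => [p pw|p []//]; split => //.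
    by rewrite /cylinder/= (tk _ pw).
  right; apply/seteqP; split=> // p [pv /tk]; rewrite pv => /esym/eqP.
  by rewrite (negbTE ne).
- by move=> _; left; exists [::] => //; apply/seteqP.
- by rewrite bigcup_const//; exists 0%N.
- move=> _ [[[|t w] _ <-]|->]; last by rewrite !measure0.
    have -> : cylinder [::] = [set: paths D] by apply/seteqP.
    by transitivity (1%E : \bar R); [|apply/esym]; exact: probability_setT.
  have [->|ts] := eqVneq t s; first exact: etrans (hmu w) (esym (hnu w)).
  exact: etrans (hd _ hmu _ _ ts) (esym (hd _ hnu _ _ ts)).
- by move=> _; rewrite (le_lt_trans (probability_le1 mu measurableT)) ?ltry.
Qed.

(* The measure on infinite paths from [s], characterized by its values on
   cylinders: see [Pr_cylinder] and [path_measure_unique]. *)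
Definition Pr (R : realType) (D : markov_chain R) (s : D)
    : probability (paths D) R :=
  projT1 (cid (exists_path_measure s)).

Lemma Pr_cylinder (R : realType) (D : markov_chain R) (s : D) :
  is_path_measure s (Pr s).
Proof. by rewrite /Pr; case: cid. Qed.

Definition reach_le (R : realType) (D : markov_chain R) (k : nat) (G : {set D})
    : set (paths D) :=
  [set p : infpath D | exists2 j, (j <= k)%N & p j \in G].

Definition reach (R : realType) (D : markov_chain R) (G : {set D})
    : set (paths D) :=
  [set p : infpath D | exists j, p j \in G].

Definition stay_le (R : realType) (D : markov_chain R) (k : nat) (H : {set D})
    : set (paths D) :=
  [set p : infpath D | forall j, (j <= k)%N -> p j \in H].

Definition S_zero (R : realType) (D : markov_chain R) (G : {set D}) : {set D} :=
  [set s : D | Pr s (reach G) == 0%E]%SET.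

Definition S_unknown (R : realType) (D : markov_chain R) (G : {set D})
    : {set D} :=
  ~: (G :|: S_zero G)%SET.

(* Main.v *)
(* Write x s for Pr_s(reach G).  Off G the function x is harmonic, being the
   limit of Pr_s(reach_le n G), and it vanishes on S_zero.  Hence if
   m <= x <= M on S_?, the one-step equations give by induction on k, for all s,
     Pr_s(reach_le k G) + Pr_s(stay_le k S_?) m <= x s
                        <= Pr_s(reach_le k G) + Pr_s(stay_le k S_?) M.
   Taking for M (for m) the maximum (minimum) of x on S_? and for s a state
   attaining it shows that the extremum is bounded by the extremal ratio. *)
Require Import Defs.
From mathcomp Require Import all_boot all_order all_algebra.
From mathcomp Require Import all_classical all_reals all_analysis.

Import Order.TTheory GRing.Theory Num.Theory.
Local Open Scope ring_scope.
Local Open Scope ereal_scope.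

(** * The Markov property for events about finitely many consecutive states *)

Section markov_property.
Set Implicit Arguments.
Unset Strict Implicit.
Context (R : realType) (D : markov_chain R).
Implicit Types (s t : D) (w : seq D) (f : pred (seq D)) (A : set (paths D)).

Local Open Scope classical_set_scope.
Local Open Scope ring_scope.

(** Real-valued, so that sums and products live in [R]; by [prob_EFin] nothing is lost on measurable
    sets. *)
Definition prob s A : R := fine (Pr s A).

Lemma prob_EFin s A : measurable A -> Pr s A = (prob s A)%:E.
Proof. by move=> mA; rewrite /prob fineK// fin_num_measure. Qed.

Lemma prob_ge0 s A : 0 <= prob s A.
Proof. by rewrite /prob fine_ge0. Qed.

Lemma prob_le s {A B : set (paths D)} :
  measurable A -> measurable B -> A `<=` B -> prob s A <= prob s B.
Proof.
by move=> mA mB AB; rewrite -lee_fin -!prob_EFin// le_measure// inE.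
Qed.

Lemma mkseq_cons (T : Type) (f : nat -> T) n :
  mkseq f n.+1 = f 0%N :: mkseq (f \o succn) n.
Proof. by rewrite /mkseq /= (iotaDl 1 0) -map_comp. Qed.

Lemma mkseq_rcons (T : Type) (f : nat -> T) n :
  mkseq f n.+1 = rcons (mkseq f n) (f n).
Proof. by rewrite /mkseq -addn1 iotaD map_cat cats1. Qed.

Lemma measurable_cylinder w : measurable (cylinder w : set (paths D)).
Proof. by apply: sub_sigma_algebra; exists w. Qed.

(** Common form of the step-bounded events: [n] states are read from time [m] on, and fixing the
    first one turns [f] into [f \o cons t]. *)
Definition window m n f : set (paths D) :=
  [set p | f (mkseq (fun i => p (m + i)%N) n)].

(** The event is a union of cylinders over words of length [m + n], and there are only countably
    many words. *)
Lemma measurable_window m n f : measurable (window m n f).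
Proof.
have -> : window m n f = \bigcup_w
    (if f (drop m w) && (size w == m + n)%N then cylinder w else set0).
  have dE (p : paths D) : drop m (mkseq p (m + n)) = mkseq (fun i => p (m + i)%N) n.
    rewrite /mkseq -map_drop drop_iota add0n addKn.
    by rewrite -[X in iota X _]addn0 iotaDl -map_comp.
  apply/seteqP; split=> [p fp|p [w _]].
    exists (mkseq p (m + n)) => //.
    by rewrite dE (fp : f _) size_mkseq eqxx /cylinder/= size_mkseq.
  by case: ifP => // /andP[fw /eqP wn] pw; rewrite /window/= -dE -wn pw.
apply: countable_bigcupT_measurable => [|w]; first exact: countableP.
by case: ifP => _; [exact: measurable_cylinder|exact: measurable0].
Qed.

Lemma prob_start s : prob s (cylinder [:: s]) = 1.
Proof. by rewrite /prob Pr_cylinder. Qed.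

(** The cylinder [[:: s]] has mass 1, so its complement is null and intersecting with it changes
    nothing. *)
Lemma prob_from_start s A : measurable A -> prob s (cylinder [:: s] `&` A) = prob s A.
Proof.
move=> mA; have mc := measurable_cylinder [:: s].
apply/eqP; rewrite eq_le prob_le//=; last exact: measurableI.
rewrite -lee_fin -!prob_EFin//; last exact: measurableI.
rewrite [leLHS](_ : _ = Pr s (A `\` cylinder [:: s]) + Pr s (A `&` cylinder [:: s]))%E; last first.
  by rewrite -measureDI.
rewrite setIC; suff -> : Pr s (A `\` cylinder [:: s]) = 0%E by rewrite add0e.
have : Pr s (~` cylinder [:: s]) = 0%E.
  by rewrite probability_setC// Pr_cylinder /= subee.
apply: subset_measure0; [exact: measurableD|exact: measurableC|by move=> p []].
Qed.

Lemma total_prob s A (X : paths D -> D) : measurable A ->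
  (forall t, measurable [set p | X p = t]) ->
  prob s A = \sum_t prob s (A `&` [set p | X p = t]).
Proof.
move=> mA mX; have mI t : measurable (A `&` [set p | X p = t]).
  exact: measurableI.
apply: EFin_inj; rewrite -sumEFin -prob_EFin//.
rewrite (eq_bigr (fun t => Pr s (A `&` [set p | X p = t]))); last first.
  by move=> t _; rewrite -prob_EFin.
rewrite fsbig_seq ?index_enum_uniq// -measure_fin_bigcup//.
- congr (Pr s _); apply/seteqP; split=> [p Ap|p [t _ []]//].
  by exists (X p) => //=; rewrite mem_index_enum.
- by move=> i j _ _ [p [[_ /= <-] [_ /= <-]]].
Qed.

Lemma word_prob_rcons s w t :
  word_prob s (rcons w t) = word_prob s w * mc_trans (last s w) t.
Proof. by elim: w s => [|u w IHw] s /=; rewrite ?mul1r ?mulr1// IHw mulrA. Qed.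

(** Conditioning on the state [t] at time [(size w).+1] lengthens the word by [t] and shortens the
    window by one. The Markov property for the shorter window is a premise, so that this step serves
    both inside the induction and after it. *)
Lemma markov_split n w s f :
  (forall w s f, prob s (cylinder (s :: w) `&` window (size w) n.+1 f) =
     word_prob s w * prob (last s w) (window 0 n.+1 f)) ->
  prob s (cylinder (s :: w) `&` window (size w) n.+2 f) =
  word_prob s w *
    \sum_t mc_trans (last s w) t * prob t (window 0 n.+1 (f \o cons (last s w))).
Proof.
move=> IHn; have mX t : measurable [set p : paths D | p (size w).+1 = t].
  rewrite [X in measurable X](_ : _ = window (size w).+1 1 (pred1 [:: t])).
    exact: measurable_window.
  by apply/seteqP; split=> p; rewrite /window/= /mkseq/= addn0 eqseq_cons andbT => /eqP.
have mA : measurable (cylinder (s :: w) `&` window (size w) n.+2 f : set (paths D)).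
  by apply: measurableI; [exact: measurable_cylinder|exact: measurable_window].
rewrite (total_prob _ mA mX) mulr_sumr; apply: eq_bigr => t _.
rewrite mulrA -word_prob_rcons.
have := IHn (rcons w t) s (f \o cons (last s w)); rewrite last_rcons => <-.
congr (prob s _).
(* Word and window overlap in one state: the window begins at time [size w], where the cylinder
   already forces [last s w]. *)
have E (p : paths D) : cylinder (s :: w) p ->
    mkseq (fun i => p (size w + i)%N) n.+2 =
    last s w :: mkseq (fun i => p (size (rcons w t) + i)%N) n.+1.
  rewrite /cylinder/= => pw; rewrite mkseq_cons addn0; congr (_ :: _).
    by rewrite -[RHS](last_cons s) -pw mkseq_rcons last_rcons.
  by apply: eq_map => i /=; rewrite size_rcons addnS.
have C (p : paths D) :
    cylinder (s :: rcons w t) p <-> cylinder (s :: w) p /\ p (size w).+1 = t.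
  rewrite /cylinder/= size_rcons mkseq_rcons -rcons_cons; split=> [|[-> ->]//].
  by move=> /eqP; rewrite eqseq_rcons => /andP[/eqP-> /eqP].
apply/seteqP; split=> p.
  by move=> [[pw fp] pt]; split; [exact/C|rewrite /window/= -E].
by move=> [/C[pw pt] fp]; split => //; split => //; rewrite /window/= E.
Qed.

(** Induction on the window length. Both sides are expanded by [markov_split], the right one with
    the empty word, and yield the same sum over successors of [last s w]. *)
Lemma markov_property n w s f :
  prob s (cylinder (s :: w) `&` window (size w) n.+1 f) =
  word_prob s w * prob (last s w) (window 0 n.+1 f).
Proof.
elim: n w s f => [|n IHn] w s f; last first.
  rewrite markov_split//; congr (_ * _).
  rewrite -(prob_from_start _ (measurable_window _ _ _)).
  by rewrite (@markov_split _ [::]) //= mul1r.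
(* A window of length one sees only the overlapping state, so on the cylinder the event is all or
   nothing. *)
have wE u v : cylinder (u :: v) `&` window (size v) 1 f =
    if f [:: last u v] then cylinder (u :: v) else set0.
  have h (p : paths D) : cylinder (u :: v) p ->
      mkseq (fun i => p (size v + i)%N) 1 = [:: last u v].
    rewrite /cylinder/= => pv; rewrite [LHS]/mkseq/= addn0; congr [:: _].
    by rewrite -[RHS](last_cons u) -pv mkseq_rcons last_rcons.
  case: ifP => fu; apply/seteqP; split=> p //=.
  - by case.
  - by move=> pv; split=> //; rewrite /window/= h.
  - by move=> [pv]; rewrite /window/= h// fu.
rewrite -(prob_from_start _ (measurable_window 0 1 f)) (wE _ [::]) wE /=.
have cE v u : prob u (cylinder (u :: v)) = word_prob u v.
  by rewrite /prob Pr_cylinder.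
by case: ifP => _; rewrite ?cE ?mulr1// /prob !measure0 mulr0.
Qed.

Lemma prob_window_step s n f :
  prob s (window 0 n.+2 f) =
  \sum_t mc_trans s t * prob t (window 0 n.+1 (f \o cons s)).
Proof.
rewrite -(prob_from_start _ (measurable_window _ _ _)).
by rewrite (@markov_split _ [::]) /= ?mul1r// => *; exact: markov_property.
Qed.

End markov_property.

(** * One-step equations and limits for reaching and staying *)

Section reachability.
Import numFieldNormedType.Exports.
Set Implicit Arguments.
Unset Strict Implicit.
Context (R : realType) (D : markov_chain R).
Implicit Types (s t : D) (G H : {set D}).

Local Open Scope classical_set_scope.
Local Open Scope ring_scope.

Lemma prob_sure s (A : set (paths D)) : measurable A ->
  (forall p : paths D, p 0%N = s -> A p) -> prob s A = 1.
Proof.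
move=> mA sA; rewrite -(prob_from_start _ mA) -(prob_start s).
by congr (prob s _); apply/setIidl => p [/sA].
Qed.

Lemma prob_impossible s (A : set (paths D)) : measurable A ->
  (forall p : paths D, p 0%N = s -> ~ A p) -> prob s A = 0.
Proof.
move=> mA sA; rewrite -(prob_from_start _ mA).
rewrite (_ : _ `&` _ = set0) ?/prob ?measure0//.
by rewrite -subset0 => p [[/sA]].
Qed.

(** The times [0] to [k] make a window of [k.+1] states. *)
Lemma reach_leE k G :
  reach_le k G = window 0 k.+1 (has (mem G)) :> set (paths D).
Proof.
apply/seteqP; split=> p; rewrite /window/mkset /mkseq has_map.
  by move=> [j jk pj]; apply/hasP; exists j => //; rewrite mem_iota ltnS.
by move=> /hasP[j]; rewrite mem_iota ltnS => /= jk pj; exists j.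
Qed.

Lemma stay_leE k H :
  stay_le k H = window 0 k.+1 (all (mem H)) :> set (paths D).
Proof.
apply/seteqP; split=> p; rewrite /window/mkset /mkseq all_map.
  by move=> pH; apply/allP => j; rewrite mem_iota ltnS => /= /pH.
by move=> /allP pH j jk; apply: pH; rewrite mem_iota ltnS.
Qed.

Lemma measurable_reach_le k G : measurable (reach_le k G : set (paths D)).
Proof. by rewrite reach_leE; exact: measurable_window. Qed.

Lemma measurable_stay_le k H : measurable (stay_le k H : set (paths D)).
Proof. by rewrite stay_leE; exact: measurable_window. Qed.

Lemma reach_bigcup G : reach G = \bigcup_k reach_le k G :> set (paths D).
Proof.
apply/seteqP; split=> p; first by move=> [j pj]; exists j => //; exists j.
by move=> [k _ [j _ pj]]; exists j.
Qed.

Lemma measurable_reach G : measurable (reach G : set (paths D)).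
Proof.
by rewrite reach_bigcup; apply: bigcup_measurable => k _; exact: measurable_reach_le.
Qed.

Lemma reach_le_subset k G : reach_le k G `<=` (reach G : set (paths D)).
Proof. by move=> p [j _ pj]; exists j. Qed.

(** Since [s] lies outside [G], prepending it to a word does not change whether the word meets
    [G]. *)
Lemma prob_reach_leS s k G : s \notin G ->
  prob s (reach_le k.+1 G) = \sum_t mc_trans s t * prob t (reach_le k G).
Proof.
move=> sG; rewrite reach_leE prob_window_step; apply: eq_bigr => t _.
by rewrite reach_leE; congr (_ * prob _ (window _ _ _)); apply/funext => w /=;
  rewrite (negbTE sG).
Qed.

Lemma prob_stay_leS s k H : s \in H ->
  prob s (stay_le k.+1 H) = \sum_t mc_trans s t * prob t (stay_le k H).
Proof.
move=> sH; rewrite stay_leE prob_window_step; apply: eq_bigr => t _.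
by rewrite stay_leE; congr (_ * prob _ (window _ _ _)); apply/funext => w /=;
  rewrite sH.
Qed.

Lemma prob_stay_le_notin s k H : s \notin H -> prob s (stay_le k H) = 0.
Proof.
move=> sH; apply: prob_impossible; first exact: measurable_stay_le.
by move=> p p0 /(_ 0%N isT); rewrite p0; apply/negP.
Qed.

Lemma prob_stay_le0 s H : s \in H -> prob s (stay_le 0 H) = 1.
Proof.
move=> sH; apply: prob_sure; first exact: measurable_stay_le.
by move=> p p0 j; rewrite leqn0 => /eqP ->; rewrite p0.
Qed.

Lemma prob_reach_le_in s k G : s \in G -> prob s (reach_le k G) = 1.
Proof.
move=> sG; apply: prob_sure; first exact: measurable_reach_le.
by move=> p p0; exists 0%N => //; rewrite p0.
Qed.

Lemma prob_reach_le0 s G : s \notin G -> prob s (reach_le 0 G) = 0.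
Proof.
move=> sG; apply: prob_impossible; first exact: measurable_reach_le.
by move=> p p0 [j]; rewrite leqn0 => /eqP ->; rewrite p0; exact/negP.
Qed.

Lemma prob_reach_in s G : s \in G -> prob s (reach G) = 1.
Proof.
move=> sG; apply: prob_sure; first exact: measurable_reach.
by move=> p p0; exists 0%N => //; rewrite p0.
Qed.

Lemma prob_reach_le_le s k G : prob s (reach_le k G) <= prob s (reach G).
Proof.
apply: prob_le; [exact: measurable_reach_le|exact: measurable_reach|].
exact: reach_le_subset.
Qed.

(** Continuity from below along the increasing events [reach_le k G]. *)
Lemma cvg_prob_reach s G :
  (fun k => prob s (reach_le k G)) @ \oo --> prob s (reach G).
Proof.
apply: fine_cvg; rewrite -prob_EFin; last exact: measurable_reach.
rewrite reach_bigcup; apply: nondecreasing_cvg_mu.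
- by move=> k; exact: measurable_reach_le.
- by rewrite -reach_bigcup; exact: measurable_reach.
- move=> m n mn; rewrite subsetEset => p [j jm pj].
  by exists j => //; exact: leq_trans mn.
Qed.

(** Limit of the one-step equations [prob_reach_leS]; it passes through the finite sum over [t]. *)
Lemma prob_reach_harmonic s G : s \notin G ->
  prob s (reach G) = \sum_t mc_trans s t * prob t (reach G).
Proof.
move=> sG; have := @cvg_prob_reach s G; rewrite -cvg_shiftS.
have -> : [sequence prob s (reach_le k.+1 G)]_k =
    (fun k => \sum_t mc_trans s t * prob t (reach_le k G)).
  by apply/funext => k; exact: prob_reach_leS.
move=> /cvg_unique; apply => //.
apply: cvg_big => [|t _]; first exact: add_continuous.
by apply: cvgMl_tmp; exact: cvg_prob_reach.
Qed.

(** * Bounds on reachability from bounds on the undecided states *)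

Section bounds.
Context (G : {set D}).
Let H := S_unknown G.

Lemma S_unknownPn s : s \notin H -> s \in G \/ s \notin G /\ prob s (reach G) = 0.
Proof.
rewrite /H /S_unknown finset.inE negbK finset.inE.
case: (boolP (s \in G)) => [|sG] /=; first by left.
by rewrite finset.inE => /eqP s0; right; split=> //; rewrite /prob s0.
Qed.

Lemma S_unknown_notin s : s \in H -> s \notin G.
Proof. by rewrite /H /S_unknown finset.inE finset.inE negb_or => /andP[]. Qed.

Lemma trans_ge0 s t : 0 <= mc_trans s t.
Proof. by have /andP[] := mc_trans01 s t. Qed.

(** Outside [H] the staying term vanishes, and either both reachability probabilities are 1 or the
    left side is 0. Inside [H] the one-step equations average the induction hypothesis with
    nonnegative weights. *)
Lemma prob_reach_le_bound M k s : (forall t, t \in H -> prob t (reach G) <= M) ->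
  prob s (reach G) <= prob s (reach_le k G) + prob s (stay_le k H) * M.
Proof.
move=> xM; elim: k s => [|k IHk] s; have [sH|sH] := boolP (s \in H).
- by rewrite prob_stay_le0// mul1r prob_reach_le0 ?add0r ?xM// S_unknown_notin.
- rewrite prob_stay_le_notin// mul0r addr0.
  by have [sG|[sG ->]] := S_unknownPn sH; rewrite ?prob_ge0// prob_reach_in// prob_reach_le_in.
- have sG := S_unknown_notin sH.
  rewrite prob_reach_harmonic// prob_reach_leS// prob_stay_leS//.
  rewrite mulr_suml -big_split/=; apply: ler_sum => t _.
  by rewrite -mulrA -mulrDr ler_wpM2l// trans_ge0.
- rewrite prob_stay_le_notin// mul0r addr0.
  by have [sG|[sG ->]] := S_unknownPn sH; rewrite ?prob_ge0// prob_reach_in// prob_reach_le_in.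
Qed.

(** Dual argument; outside [H] it suffices that bounded reachability implies reachability. *)
Lemma prob_reach_ge_bound m k s : (forall t, t \in H -> m <= prob t (reach G)) ->
  prob s (reach_le k G) + prob s (stay_le k H) * m <= prob s (reach G).
Proof.
move=> mx; elim: k s => [|k IHk] s; have [sH|sH] := boolP (s \in H).
- by rewrite prob_stay_le0// mul1r prob_reach_le0 ?add0r ?mx// S_unknown_notin.
- by rewrite prob_stay_le_notin// mul0r addr0 prob_reach_le_le.
- have sG := S_unknown_notin sH.
  rewrite prob_reach_harmonic// prob_reach_leS// prob_stay_leS//.
  rewrite mulr_suml -big_split/=; apply: ler_sum => t _.
  by rewrite -mulrA -mulrDr ler_wpM2l// trans_ge0.
- by rewrite prob_stay_le_notin// mul0r addr0 prob_reach_le_le.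
Qed.

End bounds.
End reachability.

Theorem theorem1 (R : realType) (D : markov_chain R) (G : {set D}) (k : nat)
    (hG : forall s, s \in G -> absorbing s)
    (hne : S_unknown G <> finset.set0)
    (hk : forall s, s \in S_unknown G -> Pr s (stay_le k (S_unknown G)) < 1) :
  let ratio (s : D) := Pr s (reach_le k G) / (1 - Pr s (stay_le k (S_unknown G))) in
  let sI := mc_init D in
  Pr sI (reach_le k G) + Pr sI (stay_le k (S_unknown G)) *
      \big[mine/+oo]_(s in S_unknown G) ratio s
    <= Pr sI (reach G)
  /\
  Pr sI (reach G)
    <= Pr sI (reach_le k G) + Pr sI (stay_le k (S_unknown G)) *
      \big[maxe/-oo]_(s in S_unknown G) ratio s.
Proof.
move=> ratio sI.
have mR := @measurable_reach_le _ D k G.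
have mQ := @measurable_stay_le _ D k (S_unknown G).
have mX := @measurable_reach _ D G.
have Q1 s : s \in S_unknown G -> (prob s (stay_le k (S_unknown G)) < 1)%R.
  by move=> /hk; rewrite prob_EFin// lte_fin.
(* By [Q1] the denominator is positive, so the extended-real inverse is the real one rather than
   [+oo]. *)
have ratioE s : s \in S_unknown G -> ratio s =
    (prob s (reach_le k G) / (1 - prob s (stay_le k (S_unknown G))))%:E.
  move=> sH; rewrite /ratio !prob_EFin// -EFinB inver.
  by rewrite gt_eqF ?subr_gt0 ?Q1.
have [s0 sH0] : exists s, s \in S_unknown G.
  by apply/set0Pn/eqP.
rewrite (prob_EFin sI mX) (prob_EFin sI mR); split.
(* The state [s] minimizes reachability, not the ratio; its value is an admissible [m] for every
   starting state. *)
- have [s sH xmin] := arg_minP (fun s => prob s (reach G)) sH0.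
  apply: (@le_trans _ _ (prob sI (reach_le k G) +
    prob sI (stay_le k (S_unknown G)) * prob s (reach G))%:E); last first.
    by rewrite lee_fin prob_reach_ge_bound.
  rewrite EFinD EFinM -(prob_EFin sI mQ) leeD2l// lee_wpmul2l//.
  apply: le_trans (bigmin_le_cond _ _ sH) _; rewrite ratioE// lee_fin.
  (* Clearing the denominator turns the claim that the ratio at [s] is at most its reachability into
     the lower bound started at [s] itself. *)
  rewrite ler_pdivrMr ?subr_gt0 ?Q1// mulrBr mulr1 lerBrDr mulrC.
  exact: prob_reach_ge_bound.
- have [s sH xmax] := arg_maxP (fun s => prob s (reach G)) sH0.
  apply: (@le_trans _ _ (prob sI (reach_le k G) +
    prob sI (stay_le k (S_unknown G)) * prob s (reach G))%:E).
    by rewrite lee_fin prob_reach_le_bound.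
  rewrite EFinD EFinM -(prob_EFin sI mQ) leeD2l// lee_wpmul2l//.
  apply: le_trans (le_bigmax_cond _ _ sH); rewrite ratioE// lee_fin.
  (* Likewise, the ratio at the maximizer dominates its reachability by the upper bound started
     there. *)
  rewrite ler_pdivlMr ?subr_gt0 ?Q1// mulrBr mulr1 lerBlDr mulrC.
  exact: prob_reach_le_bound.
Qed.
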